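(* Let $\xi=(\xi_t)_{0\le t\le T}$ be the observed process $$\xi_t=a(t)+\sigma(t)B^H_t,\qquad 0\le t\le T,$$ where $B^H$ is a standard fractional Brownian motion with Hurst index $H\in(0,1)$, and let the drift coefficient have the form $$a(t)=\sum_{i=0}^n\theta_i\varphi_i(t)=\boldsymbol\theta^\top\boldsymbol\varphi(t),\qquad \boldsymbol\varphi(t)=(\varphi_0(t),\ldots,\varphi_n(t))^\top,$$ with an unknown nonrandom vector $\boldsymbol\theta=(\theta_0,\ldots,\theta_n)^\top\in\mathbb{R}^{n+1}$. Then the maximum likelihood estimate $\widehat{\boldsymbol\theta}_{\rm ML}=\arg\max_{\boldsymbol\theta}\Lambda^H_t(\boldsymbol\theta)$ of $\boldsymbol\theta$ from the observations $\{\xi_s,\,0\le s\le t\}$ is $$\widehat{\boldsymbol\theta}_{\rm ML}=R_H^{-1}(t)\,\boldsymbol\psi^H_t ,$$ where $R_H(t)$ (assumed invertible) is the nonrandom matrix with elements $$(R_H(t))_{ij}=\int_0^t\psi_i(s)\psi_j(s)\,dw^H_s,\qquad i,j=0,\ldots,n,$$ and $\boldsymbol\psi^H=(\boldsymbol\psi^H_t)_{0\le t\le T}$ is the stochastic process with values in $\mathbb{R}^{n+1}$ and coordinates $$(\boldsymbol\psi^H_t)_i=\int_0^t\psi_i(s)\,dM^H_s,\qquad i=0,\ldots,n,$$ with $$\psi_i(t)=\frac{d}{dw^H_t}\int_0^tk_H(t,s)\,\sigma^{-1}(s)\,\varphi_i'(s)\,ds,\quad i=0,\ldots,n,\qquad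 M^H_t=\int_0^tk_H(t,s)\,d\xi_s .$$
   Context: A standard fractional Brownian motion $B^H=(B^H_t)_{0\le t\le T}$ with Hurst index $H\in(0,1)$ is a Gaussian process with continuous paths, $B^H_0=0$, $\mathbf{E}\,B^H_t=0$ and $\mathbf{E}\,B^H_sB^H_t=\frac12\left(s^{2H}+t^{2H}-|t-s|^{2H}\right)$. Notation, for $0\le s<t\le T$: $\kappa_H=2H\,\Gamma(\tfrac32-H)\,\Gamma(\tfrac12+H)$, $k_H(t,s)=\kappa_H^{-1}s^{1/2-H}(t-s)^{1/2-H}$, $\lambda_H=\dfrac{2H\,\Gamma(3-2H)\,\Gamma(\frac12+H)}{\Gamma(\frac32-H)}$, $w_H(t)=\lambda_H^{-1}t^{2-2H}$, $dw^H_t=\lambda_H^{-1}(2-2H)t^{1-2H}\,dt$, and $\dfrac{df(t)}{dw^H_t}=\dfrac{\lambda_H}{2-2H}\,t^{2H-1}\,\dfrac{df(t)}{dt}$. The functions $\varphi_i$ are known with $\int_0^T|\varphi_i(t)|\,dt<\infty$, so that $\int_0^T|a(t)|\,dt<\infty$; $\sigma$ is known with $\int_0^T|\sigma(t)|^2\,dt<\infty$. The derivatives, inverses and integrals written are assumed to be well defined. The stochastic differential of $\xi$ is written as $d\xi_t=\sum_{i=0}^n\theta_i\varphi_i'(t)\,dt+\sigma(t)\,dB^H_t$. With $$Q^{\boldsymbol\theta}_H(t)=\frac{d}{dw^H_t}\int_0^tk_H(t,s)\,\sigma^{-1}(s)\sum_{i=0}^n\theta_i\varphi_i'(s)\,ds=\sum_{i=0}^n\theta_i\psi_i(t),$$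 assumed to belong to $L^2([0,T],dw^H_t)$, the likelihood process is $$\Lambda^H_t(\boldsymbol\theta)=\exp\Big\{\int_0^tQ_H^{\boldsymbol\theta}(s)\,dM^H_s-\frac12\int_0^t\big(Q_H^{\boldsymbol\theta}(s)\big)^2dw^H_s\Big\}=\exp\Big\{\boldsymbol\theta^\top\boldsymbol\psi^H_t-\frac12\boldsymbol\theta^\top R_H(t)\boldsymbol\theta\Big\},$$ which serves as the Radon–Nikodym derivative of the measure generated by the observations $\xi$ with respect to the measure of the process $\xi_s=B^H_s$, $s\le t$. *)

(* Defs.v *)
From HB Require Import structures.
From mathcomp Require Import all_boot all_order all_algebra.
From mathcomp Require Import all_classical all_reals all_analysis.

Set Implicit Arguments.
Unset Strict Implicit.
Unset Printing Implicit Defensive.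

Import Order.TTheory GRing.Theory Num.Theory.
Import numFieldNormedType.Exports.

Local Open Scope classical_set_scope.
Local Open Scope ring_scope.

(* In the integrals below the values of the integrands at the endpoints, where
   [powR] is total ([0 `^ a = 0] for [a != 0]) and two-sided derivatives
   carry no information, are immaterial. *)
Section Kernel.
Context {R : realType}.
Implicit Types (H t s : R) (f : R -> R).

Definition Gamma (z : R) : R :=
  \int[@lebesgue_measure R]_(x in `]0, +oo[) (x `^ (z - 1) * expR (- x)).

Definition kappa H : R := 2 * H * Gamma (3 / 2 - H) * Gamma (1 / 2 + H).

Definition lambda H : R :=
  2 * H * Gamma (3 - 2 * H) * Gamma (1 / 2 + H) / Gamma (3 / 2 - H).

Definition kH H t s : R :=
  (kappa H)^-1 * s `^ (1 / 2 - H) * (t - s) `^ (1 / 2 - H).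

Definition dw_density H s : R :=
  (lambda H)^-1 * (2 - 2 * H) * s `^ (1 - 2 * H).

Definition int_dw H t f : R :=
  \int[@lebesgue_measure R]_(s in `[0, t]) (f s * dw_density H s).

Definition ddw H f t : R :=
  lambda H / (2 - 2 * H) * t `^ (2 * H - 1) * derive1 f t.

Definition L2dw_norm2 H t f : \bar R :=
  (\int[@lebesgue_measure R]_(s in `[0%R, t]) ((f s) ^+ 2 * dw_density H s)%:E)%E.

Definition L1_norm t f : \bar R :=
  (\int[@lebesgue_measure R]_(s in `[0%R, t]) (`|f s|)%:E)%E.

Definition in_L2dw H t f : Prop :=
  measurable_fun `[0, t] f /\ (L2dw_norm2 H t f < +oo)%E.

End Kernel.

Section Fbm.
Context {R : realType} {d : measure_display} {Om : measurableType d}.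
Variable P : probability Om R.

(* [normal_prob m 0] is not a point mass in the library, hence the separate
   degenerate case. *)
Definition gaussian_rv (X : Om -> R) : Prop :=
  measurable_fun setT X /\
  exists m v : R, 0 <= v /\
    if v == 0 then {ae P, forall w, X w = m}
    else forall A : set R, measurable A ->
           P (X @^-1` A) = normal_prob m (Num.sqrt v) A.

Definition gaussian_process (T : R) (X : R -> Om -> R) : Prop :=
  forall (m : nat) (c s : 'I_m -> R), (forall j, 0 <= s j <= T) ->
    gaussian_rv (fun w => \sum_(j < m) c j * X (s j) w).

Definition is_fbm (H T : R) (B : R -> Om -> R) : Prop :=
  [/\ gaussian_process T B,
      forall w, {within `[0, T], continuous (fun t => B t w)},
      forall w, B 0 w = 0,
      forall t, 0 <= t <= T -> ('E_P[B t] = 0)%E &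
      forall s t, 0 <= s <= T -> 0 <= t <= T ->
        'E_P[fun w => (B s w * B t w)%R]%E =
          (2^-1 * (s `^ (2 * H) + t `^ (2 * H) - `|t - s| `^ (2 * H)))%:E].

End Fbm.

Section StochasticIntegral.
Context {R : realType} {d : measure_display} {Om : measurableType d}.
Variable P : probability Om R.

(* An elementary integrand is a list of triples [(c, a, b)], standing for the
   step function [sum of c * 1_]a, b]]; the intervals may overlap. *)
Definition step := seq (R * R * R).

Definition step_on (t : R) (e : step) : Prop :=
  forall p, p \in e -> [&& 0 <= p.1.2, p.1.2 <= p.2 & p.2 <= t].

Definition step_fun (e : step) (x : R) : R :=
  \sum_(p <- e) p.1.1 * \1_(`]p.1.2, p.2]) x.

Definition step_int (X : R -> Om -> R) (e : step) (w : Om) : R :=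
  \sum_(p <- e) p.1.1 * (X p.2 w - X p.1.2 w).

(* The graph of the integral of nonrandom functions over [0, t] with respect to
   [X]: the closure of the elementary integral for the mode of convergence [N]
   of the integrands and mean-square convergence of the integrals. *)
Definition integral_graph (N : (R -> R) -> \bar R) (X : R -> Om -> R) (t : R)
    (f : R -> R) (Y : Om -> R) : Prop :=
  measurable_fun setT Y /\
  exists e : nat -> step,
    [/\ forall k, step_on t (e k),
        (fun k => N (fun x => step_fun (e k) x - f x)) @ \oo --> 0%E &
        (fun k => 'E_P[fun w => ((step_int X (e k) w - Y w) ^+ 2)%R]%E)
          @ \oo --> 0%E].

(* The second clause says that the integral is well defined: its value does
   not depend, up to null sets, on the approximating step functions. *)
Definition is_integral N X t f Y : Prop :=
  integral_graph N X t f Y /\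
  forall Y', integral_graph N X t f Y' -> {ae P, forall w, Y' w = Y w}.

(* Integrals with respect to fractional Brownian motion and to the observed
   process: convergence in mean of the integrands makes the fractional Wiener
   integral closable for every H in (0, 1), whereas no Lebesgue norm makes it
   continuous when H < 1/2. *)
Definition is_int_dX (X : R -> Om -> R) (t : R) f Y : Prop :=
  is_integral (L1_norm t) X t f Y.

(* Integrals with respect to the process M, for integrands in L2(dw). *)
Definition is_int_dM (H : R) (M : R -> Om -> R) (t : R) f Y : Prop :=
  is_integral (L2dw_norm2 H t) M t f Y.

End StochasticIntegral.

Section Model.
Context {R : realType} {d : measure_display} {Om : measurableType d}.
Variables (P : probability Om R) (n : nat) (H : R).
Variables (phi : 'I_n.+1 -> R -> R) (sigma : R -> R).
Implicit Types (theta : 'cV[R]_n.+1) (t s : R).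

Definition drift theta s : R := \sum_(i < n.+1) theta i 0 * phi i s.

Definition drift' theta s : R := \sum_(i < n.+1) theta i 0 * derive1 (phi i) s.

(* [Y] is the integral of [f] over [0, t] against [d xi].  The first case reads
   it literally, with respect to [xi = drift + sigma B]; the second one through
   the formal differential [d xi = drift' ds + sigma dB].  The two agree for
   constant [sigma]; for general [sigma] both are admitted. *)
Definition is_int_dxi theta (B xi : R -> Om -> R) t (f : R -> R)
    (Y : Om -> R) : Prop :=
  is_int_dX P xi t f Y \/
  [/\ measurable_fun setT Y,
      (@lebesgue_measure R).-integrable `[0, t]
        (fun s => (f s * drift' theta s)%:E) &
      exists2 Z, is_int_dX P B t (fun s => f s * sigma s) Z &
        {ae P, forall w, Y w =
          \int[@lebesgue_measure R]_(s in `[0, t]) (f s * drift' theta s)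
          + Z w}].

Definition psi_primitive (i : 'I_n.+1) t : R :=
  \int[@lebesgue_measure R]_(s in `[0, t])
    (kH H t s * (sigma s)^-1 * derive1 (phi i) s).

Definition psi (i : 'I_n.+1) : R -> R := ddw H (psi_primitive i).

Definition Q theta : R -> R :=
  ddw H (fun t => \int[@lebesgue_measure R]_(s in `[0, t])
    (kH H t s * (sigma s)^-1 * drift' theta s)).

Definition RH t : 'M[R]_n.+1 :=
  \matrix_(i, j) int_dw H t (fun s => psi i s * psi j s).

(* The likelihood of each parameter is only defined up to a null set; a regular
   version, continuous in the parameter, is needed for the maximisation over
   the uncountably many parameters to make sense. *)
Definition is_likelihood (M : R -> Om -> R) t
    (L : 'cV[R]_n.+1 -> Om -> R) : Prop :=
  (forall theta, exists2 I, is_int_dM P H M t (Q theta) I &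
     {ae P, forall w, L theta w =
        expR (I w - 2^-1 * int_dw H t (fun s => (Q theta s) ^+ 2))}) /\
  {ae P, forall w, continuous (fun theta => L theta w)}.

Definition argmax (f : 'cV[R]_n.+1 -> R) : set 'cV[R]_n.+1 :=
  [set theta | forall eta, f eta <= f theta].

Definition is_mle (M : R -> Om -> R) t (est : Om -> 'cV[R]_n.+1) : Prop :=
  (exists L, is_likelihood M t L) /\
  forall L, is_likelihood M t L ->
    {ae P, forall w, argmax (fun theta => L theta w) = [set est w]}.

End Model.

(* Main.v *)
Require Import Defs.
From HB Require Import structures.
From mathcomp Require Import all_boot all_order all_algebra.
From mathcomp Require Import all_classical all_reals all_analysis.
From mathcomp Require Import measurable_realfun ring lra.

Set Implicit Arguments.
Unset Strict Implicit.
Unset Printing Implicit Defensive.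

Import Order.TTheory GRing.Theory Num.Theory.
Import numFieldNormedType.Exports.

Local Open Scope classical_set_scope.
Local Open Scope ring_scope.

(** The log-likelihood is a concave quadratic function of the parameter, and
    the estimate is its vertex.

    The map [Q] is built from integrals and a derivative, so that
    [Q eta = sum_i eta_i psi_i] almost everywhere ([Q_linear_ae]).  Hence
    [int Q(eta)^2 dw = eta^T A eta], where [A = RH H phi sigma t] is the Gram
    matrix of the [psi_i] in [L2(dw)]; it is symmetric and positive
    semidefinite, hence definite when it is invertible.  On the stochastic side
    the integral against [M] is linear ([is_int_dM_comb], [is_int_dM_sum]), so
    that [int Q(eta) dM = eta^T Psi] almost surely.  Completing the square in
    [eta^T Psi - eta^T A eta / 2] shows that it is maximal exactly at
    [A^-1 Psi] ([concave_quadratic_argmax]).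

    Each of these almost sure identities holds off a null set that depends on
    the parameter, while the maximum runs over uncountably many parameters.
    One null set serves all rational parameters ([ae_forall_countable]), and
    continuity in the parameter, shared by the given version of the likelihood
    and by the exponential of the quadratic form, extends the identity to all
    parameters ([eq_continuous_rat]). *)

(** * Maximum of a concave quadratic function *)

Section QuadraticForm.
Context {R : realFieldType} {n : nat}.
Implicit Types (A : 'M[R]_n) (b x y : 'cV[R]_n).

Definition bilin A x y : R := (x^T *m A *m y) 0 0.

Lemma bilinDl A x y z a : bilin A (x + a *: y) z = bilin A x z + a * bilin A y z.
Proof. by rewrite /bilin linearD linearZ /= !mulmxDl -!scalemxAl !mxE. Qed.

Lemma bilinDr A x y z a : bilin A z (x + a *: y) = bilin A z x + a * bilin A z y.
Proof. by rewrite /bilin mulmxDr -scalemxAr !mxE. Qed.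

Lemma bilinC A x y : A^T = A -> bilin A x y = bilin A y x.
Proof.
move=> sA; have -> : bilin A y x = (y^T *m A *m x)^T 0 0 by rewrite mxE.
by rewrite !trmx_mul sA trmxK mulmxA.
Qed.

(** A vector on which a semidefinite form vanishes is a minimum of the form, so
    the gradient [2 A x] vanishes there; invertibility then gives [x = 0]. *)
Lemma psd_unit_definite A x : A^T = A -> (forall y, 0 <= bilin A y y) ->
  A \in unitmx -> bilin A x x = 0 -> x = 0.
Proof.
move=> sA A0 uA xx0.
suff Ax0 : A *m x = 0 by rewrite -(mulKmx uA x) Ax0 mulmx0.
apply/matrixP => i j; rewrite ord1 [RHS]mxE.
set p := (A *m x) i 0.
have yx : bilin A (delta_mx i 0) x = p.
  by rewrite /bilin trmx_delta -mulmxA -rowE mxE.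
set q := bilin A (delta_mx i 0) (delta_mx i 0).
have q0 : 0 <= q by exact: A0.
(* The step along the i-th axis makes the linear term beat the quadratic one;
   the shift [q + 1] avoids a division by zero. *)
have := A0 (x + (- p / (q + 1)) *: delta_mx i 0).
rewrite bilinDl !bilinDr (bilinC x) // yx xx0 -/q add0r => h.
have q1 : 0 < q + 1 by lra.
set s := - p / (q + 1) in h.
have sp : p = - s * (q + 1) by rewrite /s; field; rewrite gt_eqF.
move: h; rewrite sp => h.
have : s ^+ 2 * (q + 2) <= 0 by nra.
rewrite pmulr_lle0; last by lra.
rewrite le_eqVlt ltNge sqr_ge0 orbF sqrf_eq0 => /eqP ->.
by rewrite oppr0 mul0r.
Qed.

Lemma concave_quadratic_argmax A b x : A^T = A ->
  (forall y, 0 <= bilin A y y) -> A \in unitmx ->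
  (forall y, (y^T *m b) 0 0 - 2^-1 * bilin A y y
               <= (x^T *m b) 0 0 - 2^-1 * bilin A x x) <->
  x = invmx A *m b.
Proof.
move=> sA A0 uA; set m := invmx A *m b.
have Am : A *m m = b by rewrite mulKVmx.
have square y : (y^T *m b) 0 0 - 2^-1 * bilin A y y =
    2^-1 * bilin A m m - 2^-1 * bilin A (y - m) (y - m).
  rewrite -Am mulmxA -/(bilin A y m).
  rewrite -[in RHS](scaleN1r m) bilinDl !bilinDr (bilinC m y) //; by field.
split=> [xmax|-> y]; last first.
  by rewrite !square subrr lerB // ler_wpM2l // {1}/bilin mulmx0 mxE A0.
apply/eqP; rewrite -subr_eq0; apply/eqP; apply: (psd_unit_definite sA A0 uA).
apply/le_anti; rewrite A0 andbT.
have := xmax m; rewrite !square subrr.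
have -> : bilin A 0 0 = 0 by rewrite /bilin mulmx0 mxE.
lra.
Qed.

End QuadraticForm.

(** * Linear combinations in weighted L2 spaces *)

Section WeightedL2.
Context {R : realType} {d : measure_display} {T : measurableType d}.
Variable mu : {measure set T -> \bar R}.

(** Follows from [(u + v)^2 <= 2 u^2 + 2 v^2].  Integrating over an arbitrary
    measure with a weight covers both modes of convergence in the definition of
    the stochastic integral: [L2(dw)] for the integrands, and mean square, with
    weight 1, for the random variables. *)
Lemma le_integral_sqr_comb (D : set T) (w f g : T -> R) (a : R) :
  measurable D -> measurable_fun D w -> (forall x, D x -> 0 <= w x) ->
  measurable_fun D f -> measurable_fun D g ->
  (\int[mu]_(x in D) ((a * f x + g x) ^+ 2 * w x)%:E <=
   (2 * a ^+ 2)%:E * \int[mu]_(x in D) (f x ^+ 2 * w x)%:E +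
   2%:E * \int[mu]_(x in D) (g x ^+ 2 * w x)%:E)%E.
Proof.
move=> mD mw w0 mf mg.
have msqr (h : T -> R) : measurable_fun D h ->
    measurable_fun D (EFin \o (fun x => h x ^+ 2 * w x)).
  move=> mh; apply/measurable_EFinP; apply: measurable_funM => //.
  exact: measurable_funX.
have sqr0 (h : T -> R) x : D x -> (0 <= (h x ^+ 2 * w x)%:E)%E.
  by move=> Dx; rewrite lee_fin mulr_ge0 ?sqr_ge0 ?w0.
have c0 : 0 <= 2 * a ^+ 2 by rewrite mulr_ge0 // sqr_ge0.
rewrite -ge0_integralZl //; [|exact: msqr|by move=> x; exact: (sqr0 f)].
rewrite -ge0_integralZl //; [|exact: msqr|by move=> x; exact: (sqr0 g)].
rewrite -ge0_integralD //; last 4 first.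
- by move=> x Dx; rewrite mule_ge0 // (sqr0 f).
- by apply: measurable_funeM; exact: msqr.
- by move=> x Dx; rewrite mule_ge0 // (sqr0 g).
- by apply: measurable_funeM; exact: msqr.
apply: ge0_le_integral => //.
- by move=> x; exact: (sqr0 (fun x => a * f x + g x)).
- apply: (msqr (fun x => a * f x + g x)); apply: measurable_funD => //.
  exact: measurable_funM.
- by apply: emeasurable_funD; apply: measurable_funeM; exact: msqr.
move=> x Dx; rewrite -!EFinM -EFinD lee_fin !mulrA -mulrDl ler_wpM2r ?w0 //.
have := sqr_ge0 (a * f x - g x); nra.
Qed.

End WeightedL2.

Lemma squeeze_comb_cvge0 (R : realType) (u v z : nat -> \bar R) (a b : R) :
  (forall k, 0 <= z k)%E -> (forall k, z k <= a%:E * u k + b%:E * v k)%E ->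
  u @ \oo --> 0%E -> v @ \oo --> 0%E -> z @ \oo --> 0%E.
Proof.
move=> z0 zle u0 v0.
apply: (@squeeze_cvge _ _ _ _ (cst 0%E) z (fun k => a%:E * u k + b%:E * v k)%E).
- by apply: nearW => k; rewrite z0 zle.
- exact: cvg_cst.
rewrite [X in _ --> X](_ : _ = (a%:E * 0 + b%:E * 0)%E); last first.
  by rewrite !mule0 adde0.
by apply: cvgeD; [rewrite !mule0|exact: cvgeZl..].
Qed.

(** * The density of w *)

Section Density.
Context {R : realType}.
Implicit Types (H t s : R).

Lemma Gamma_ge0 (z : R) : 0 <= Gamma z.
Proof.
by apply: Rintegral_ge0 => x _; rewrite mulr_ge0 ?powR_ge0 ?expR_ge0.
Qed.

Lemma dw_density_ge0 H s : 0 < H < 1 -> 0 <= dw_density H s.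
Proof.
move=> /andP[H0 H1]; rewrite /dw_density mulr_ge0 ?powR_ge0 // mulr_ge0 //;
  last lra.
by rewrite invr_ge0 /lambda divr_ge0 ?Gamma_ge0 // !mulr_ge0 ?Gamma_ge0 // ltW.
Qed.

Lemma measurable_dw_density H (D : set R) : measurable_fun D (dw_density H).
Proof.
by apply: measurable_funTS; apply: measurable_funM.
Qed.

(** The domain carries the sigma-algebra of the Lebesgue measure, the form
    in which integration lemmas ask for it. *)
Lemma measurable_sqr_dw_density H (D : set R) (f : R -> R) :
  measurable_fun D f ->
  measurable_fun (D : set (measurableTypeR R))
    (EFin \o (fun s => f s ^+ 2 * dw_density H s)).
Proof.
move=> mf; apply/measurable_EFinP; apply: measurable_funM.
  exact: measurable_funX.
exact: measurable_dw_density.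
Qed.

End Density.

(** * Linearity of the integral with respect to M *)

Section StepIntegral.
Context {R : realType} {d : measure_display} {Om : measurableType d}.
Implicit Types (e : step (R := R)) (X : R -> Om -> R).

Definition scale_step (a : R) e : step :=
  [seq ((a * p.1.1, p.1.2), p.2) | p <- e].

Lemma step_fun_comb a e e' x :
  step_fun (scale_step a e ++ e') x = a * step_fun e x + step_fun e' x.
Proof.
rewrite /step_fun big_cat big_map mulr_sumr; congr (_ + _).
by apply: eq_bigr => p _ /=; rewrite mulrA.
Qed.

Lemma step_int_comb X a e e' w :
  step_int X (scale_step a e ++ e') w = a * step_int X e w + step_int X e' w.
Proof.
rewrite /step_int big_cat big_map mulr_sumr; congr (_ + _).
by apply: eq_bigr => p _ /=; rewrite mulrA.
Qed.

Lemma step_on_comb t a e e' :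
  step_on t e -> step_on t e' -> step_on t (scale_step a e ++ e').
Proof.
move=> te te' p; rewrite mem_cat => /orP[/mapP[q qe ->]|]; last exact: te'.
exact: (te q).
Qed.

Lemma measurable_step_fun (D : set R) e : measurable_fun D (step_fun e).
Proof.
by apply: measurable_sum => p; apply: measurable_funM.
Qed.

Lemma measurable_step_int X t e :
  (forall s : R, 0 <= s <= t -> measurable_fun setT (X s)) -> step_on t e ->
  measurable_fun setT (step_int X e).
Proof.
move=> mX te.
have -> : step_int X e = fun w => \sum_(p <- e)
    if p \in e then p.1.1 * (X p.2 w - X p.1.2 w) else 0.
  by apply/funext => w; rewrite /step_int big_seq big_mkcond.
apply: measurable_sum => p; have [pe|//] := boolP (p \in e).
have /and3P[p0 p12 pt] := te p pe.
apply: measurable_funM => //; apply: measurable_funB; apply: mX.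
- by rewrite pt andbT (le_trans p0).
- by rewrite p0 (le_trans p12).
Qed.

End StepIntegral.

Section IntegralLinear.
Context {R : realType} {d : measure_display} {Om : measurableType d}.
Variables (P : probability Om R) (H t : R) (X : R -> Om -> R).
Hypothesis H01 : 0 < H < 1.
Hypothesis mX : forall s : R, 0 <= s <= t -> measurable_fun setT (X s).
Implicit Types (f g : R -> R) (Y Z : Om -> R) (a : R).

Local Notation graph := (integral_graph P (L2dw_norm2 H t) X t).
Local Notation isint := (is_int_dM P H X t).

Lemma L2dw_norm2_ge0 f : (0 <= L2dw_norm2 H t f)%E.
Proof.
apply: integral_ge0 => s _.
by rewrite lee_fin mulr_ge0 ?sqr_ge0 ?dw_density_ge0.
Qed.

Lemma integral_graph_comb a f g Y Z :
  measurable_fun `[0, t] f -> measurable_fun `[0, t] g ->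
  graph f Y -> graph g Z ->
  graph (fun s => a * f s + g s) (fun w => a * Y w + Z w).
Proof.
move=> mf mg [mY [e [te ef eY]]] [mZ [e' [te' eg eZ]]].
split; first by apply: measurable_funD => //; exact: measurable_funM.
exists (fun k => scale_step a (e k) ++ e' k); split.
- by move=> k; exact: step_on_comb.
- apply: squeeze_comb_cvge0 ef eg => k; first exact: L2dw_norm2_ge0.
  rewrite [X in (X <= _)%E](_ : _ = (\int[lebesgue_measure]_(s in `[0%R, t])
     ((a * (step_fun (e k) s - f s) + (step_fun (e' k) s - g s)) ^+ 2
       * dw_density H s)%:E)%E); last first.
    by apply: eq_integral => s _; rewrite step_fun_comb;
      congr (_ ^+ 2 * _)%:E; ring.
  apply: le_integral_sqr_comb => //.
  + exact: measurable_dw_density.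
  + by move=> s _; exact: dw_density_ge0.
  + by apply: measurable_funB => //; exact: measurable_step_fun.
  + by apply: measurable_funB => //; exact: measurable_step_fun.
- apply: squeeze_comb_cvge0 eY eZ => k.
    by rewrite unlock; apply: integral_ge0 => w _; rewrite lee_fin sqr_ge0.
  have E2 (U : Om -> R) :
      ('E_P[fun w => (U w ^+ 2)%R] = \int[P]_w (U w ^+ 2 * 1)%:E)%E.
    by rewrite unlock; apply: eq_integral => w _; rewrite mulr1.
  rewrite !E2.
  rewrite [X in (X <= _)%E](_ : _ = (\int[P]_w
     ((a * (step_int X (e k) w - Y w) + (step_int X (e' k) w - Z w)) ^+ 2
       * 1)%:E)%E); last first.
    by apply: eq_integral => w _; rewrite step_int_comb;
      congr (_ ^+ 2 * _)%:E; ring.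
  apply: (@le_integral_sqr_comb _ _ _ P setT (cst 1)) => //.
  + by apply: measurable_funB => //; exact: (measurable_step_int mX).
  + by apply: measurable_funB => //; exact: (measurable_step_int mX).
Qed.

(** Uniqueness: if [Y'] is a value of the integral of [a f + g], then
    [- a Y + Y'] is one of [- a f + (a f + g) = g], hence equals [Z] almost
    surely. *)
Lemma is_int_dM_comb a f g Y Z :
  measurable_fun `[0, t] f -> measurable_fun `[0, t] g ->
  isint f Y -> isint g Z ->
  isint (fun s => a * f s + g s) (fun w => a * Y w + Z w).
Proof.
move=> mf mg [fY _] [gZ uZ]; split; first exact: integral_graph_comb.
move=> Y' fgY'.
have mfg : measurable_fun `[0, t] (fun s => a * f s + g s).
  by apply: measurable_funD => //; exact: measurable_funM.
have := integral_graph_comb (- a) mf mfg fY fgY'.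
rewrite (_ : (fun s => - a * f s + _) = g); last by apply/funext => s; ring.
by move=> /uZ; apply: filterS => w <-; ring.
Qed.

(** The index [i0] is for the empty sum: that 0 has a unique integral, equal to
    0, is obtained from [0 = - f + f], hence from some integrable [f]. *)
Lemma is_int_dM_sum (I : Type) (r : seq I) (c : I -> R) (f : I -> R -> R)
    (Y : I -> Om -> R) (i0 : I) :
  (forall i, measurable_fun `[0, t] (f i)) -> (forall i, isint (f i) (Y i)) ->
  isint (fun s => \sum_(i <- r) c i * f i s) (fun w => \sum_(i <- r) c i * Y i w).
Proof.
move=> mf fY; elim: r => [|i r IHr].
  have := is_int_dM_comb (- 1) (mf i0) (mf i0) (fY i0) (fY i0).
  congr isint; apply/funext => s; rewrite big_nil; ring.
under eq_fun do rewrite big_cons.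
rewrite (_ : (fun w => \sum_(j <- i :: r) _) =
    fun w => c i * Y i w + \sum_(j <- r) c j * Y j w); last first.
  by apply/funext => w; rewrite big_cons.
apply: is_int_dM_comb => //.
by apply: measurable_sum => j; exact: measurable_funM.
Qed.

Lemma ae_eq_is_int_dM f g Y :
  measurable_fun `[0, t] f -> measurable_fun `[0, t] g ->
  ae_eq (@lebesgue_measure R) `[0, t]%classic f g -> isint f Y -> isint g Y.
Proof.
move=> mf mg fg.
have graphE Z : graph f Z <-> graph g Z.
  suff normE e : L2dw_norm2 H t (fun x => step_fun e x - f x) =
                 L2dw_norm2 H t (fun x => step_fun e x - g x).
    have sub f' g' : (forall e, L2dw_norm2 H t (fun x => step_fun e x - f' x) =
        L2dw_norm2 H t (fun x => step_fun e x - g' x)) ->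
        graph f' Z -> graph g' Z.
      move=> fg' [mZ [e [te ef eZ]]]; split=> //; exists e; split=> //.
      by under eq_fun do rewrite -fg'.
    by split; apply: sub.
  have mN (h : R -> R) : measurable_fun `[0, t] h ->
      measurable_fun `[0, t] (fun s => step_fun e s - h s).
    by move=> mh; apply: measurable_funB => //; exact: measurable_step_fun.
  apply: ae_eq_integral => //.
  - exact: (measurable_sqr_dw_density _ (mN f mf)).
  - exact: (measurable_sqr_dw_density _ (mN g mg)).
  by move: fg; apply: filterS => s /[apply] ->.
by move=> [/graphE gY uY]; split=> // Y' /graphE; exact: uY.
Qed.

End IntegralLinear.

(** * Bilinearity of the inner product of L2(dw) *)

Lemma integrable_Rintegral_comb (d : measure_display) (T : measurableType d)
    (R : realType) (mu : {measure set T -> \bar R}) (D : set T) (I : Type)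
    (r : seq I) (c : I -> R) (f : I -> T -> R) : measurable D ->
  (forall i, mu.-integrable D (EFin \o f i)) ->
  mu.-integrable D (EFin \o (fun s => \sum_(i <- r) c i * f i s)) /\
  \int[mu]_(s in D) (\sum_(i <- r) c i * f i s) =
    \sum_(i <- r) c i * \int[mu]_(s in D) f i s.
Proof.
move=> mD fi.
have cfi i : mu.-integrable D (EFin \o (fun s => c i * f i s)).
  exact: (integrableZl mD (c i) (fi i)).
elim: r => [|i r [IHi IHr]].
  split; last first.
    under eq_Rintegral do rewrite big_nil.
    by rewrite /Rintegral integral0 big_nil.
  rewrite (_ : _ \o _ = cst 0%E); first exact: integrable0.
  by apply/funext => s /=; rewrite big_nil.
split.
  apply: (eq_integrable mD _ _ _ (integrableD mD (cfi i) IHi)).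
  by move=> s _ /=; rewrite big_cons EFinD.
under eq_Rintegral do rewrite big_cons.
by rewrite RintegralD // RintegralZl // IHr big_cons.
Qed.

Section LinearDrift.
Context {R : realType}.
Local Notation mu := (@lebesgue_measure R).
Implicit Types (H t T : R).

(** Domination: [|f g| <= f^2 + g^2]. *)
Lemma in_L2dw_integrable_mul H t (f g : R -> R) : 0 < H < 1 ->
  in_L2dw H t f -> in_L2dw H t g ->
  mu.-integrable `[0, t] (EFin \o (fun s => f s * g s * dw_density H s)).
Proof.
move=> H01 [mf f2] [mg g2].
have isqr (h : R -> R) : measurable_fun `[0, t] h -> (L2dw_norm2 H t h < +oo)%E ->
    mu.-integrable `[0, t] (EFin \o (fun s => h s ^+ 2 * dw_density H s)).
  move=> mh h2; apply/integrableP; split.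
    exact: (measurable_sqr_dw_density _ mh).
  apply: le_lt_trans h2; rewrite le_eqVlt; apply/orP; left; apply/eqP.
  apply: eq_integral => s _ /=.
  by rewrite ger0_norm // mulr_ge0 ?sqr_ge0 ?dw_density_ge0.
have mI : measurable (`[0, t]%classic : set (measurableTypeR R)).
  exact: measurable_itv.
apply: (le_integrable mI _ _ (integrableD mI (isqr f mf f2) (isqr g mg g2))).
  apply/measurable_EFinP; apply: measurable_funM;
    last exact: measurable_dw_density.
  exact: measurable_funM.
move=> s _ /=; rewrite ?lee_fin -mulrDl !(normrM _ (dw_density H s)).
rewrite ler_wpM2r // [leRHS]ger0_norm ?addr_ge0 ?sqr_ge0 //.
rewrite ler_norml; have := sqr_ge0 (f s - g s); have := sqr_ge0 (f s + g s).
by move=> *; apply/andP; split; nra.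
Qed.

Lemma in_L2dw_le H t T (f : R -> R) : 0 < H < 1 -> t <= T ->
  in_L2dw H T f -> in_L2dw H t f.
Proof.
move=> H01 tT [mf f2].
have tTI : `[0, t]%classic `<=` `[0, T]%classic.
  by apply: subset_itvl; rewrite bnd_simp.
split; first exact: measurable_funS mf.
apply: le_lt_trans f2; apply: ge0_subset_integral => //.
  exact: (measurable_sqr_dw_density _ mf).
by move=> s _; rewrite lee_fin mulr_ge0 ?sqr_ge0 ?dw_density_ge0.
Qed.

Lemma int_dw_sqr_sum H t (m : nat) (c : 'I_m -> R) (f : 'I_m -> R -> R) :
  0 < H < 1 -> (forall i, in_L2dw H t (f i)) ->
  int_dw H t (fun s => (\sum_i c i * f i s) ^+ 2) =
  \sum_i \sum_j c i * int_dw H t (fun s => f i s * f j s) * c j.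
Proof.
move=> H01 fL2.
rewrite pair_big /= /int_dw.
have [_ sumE] := @integrable_Rintegral_comb _ _ R mu `[0, t]%classic _
  (index_enum ('I_m * 'I_m)%type) (fun p => c p.1 * c p.2)
  (fun p s => f p.1 s * f p.2 s * dw_density H s) (measurable_itv _)
  (fun p => in_L2dw_integrable_mul H01 (fL2 p.1) (fL2 p.2)).
transitivity (\sum_(p : 'I_m * 'I_m) c p.1 * c p.2 *
    \int[mu]_(s in `[0, t]) (f p.1 s * f p.2 s * dw_density H s)); last first.
  by apply: eq_bigr => p _; rewrite mulrAC.
rewrite -sumE; apply: eq_Rintegral => s _.
rewrite expr2 big_distrlr pair_big /= mulr_suml.
by apply: eq_bigr => p _ /=; ring.
Qed.

Lemma ae_open_eq_on_closed t T (f g : R -> R) : t <= T ->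
  {ae mu, forall s, 0 < s < T -> f s = g s} -> ae_eq mu `[0, t]%classic f g.
Proof.
move=> tT fg.
have ne (x : R) : {ae mu, forall s, s != x}.
  exists [set x]; split => //; first exact: lebesgue_measure_set1.
  by move=> s /= /negP; rewrite negbK => /eqP.
have Fmu := ae_filter_ringOfSetsType mu.
apply: filterS3 fg (ne 0) (ne T) => s fg s0 sT.
rewrite /= in_itv /= => /andP[s0' st].
by apply: fg; rewrite !lt_neqAle s0' eq_sym s0 sT (le_trans st).
Qed.

End LinearDrift.

(** * Linearity of Q in the parameter *)

Section Score.
Context {R : realType} {n : nat}.
Variables (H T : R) (phi : 'I_n.+1 -> R -> R) (sigma : R -> R).
Local Notation mu := (@lebesgue_measure R).
Implicit Types (eta : 'cV[R]_n.+1).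

(** This transfers to [psi] the hypothesis that every [Q eta] is in [L2(dw)]. *)
Lemma Q_delta i : Q H phi sigma (delta_mx i 0) = psi H phi sigma i.
Proof.
rewrite /Q /psi /psi_primitive.
suff -> : drift' phi (delta_mx i 0) = derive1 (phi i) by [].
apply/funext => s; rewrite /drift' (bigD1 i) //= mxE !eqxx mul1r big1 ?addr0 //.
by move=> j ji; rewrite mxE (negbTE ji) mul0r.
Qed.

Hypothesis kphi_int : forall i t, 0 < t <= T -> mu.-integrable `[0, t]
  (fun s => (kH H t s * (sigma s)^-1 * derive1 (phi i) s)%:E).
Hypothesis prim_derivable : forall i, {ae mu, forall t, 0 < t < T ->
  derivable (psi_primitive H phi sigma i) t 1}.

Lemma Q_primitive eta t : 0 < t <= T ->
  \int[mu]_(s in `[0, t]) (kH H t s * (sigma s)^-1 * drift' phi eta s) =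
  \sum_i eta i 0 * psi_primitive H phi sigma i t.
Proof.
move=> tT.
have [_ <-] := @integrable_Rintegral_comb _ _ R mu `[0, t]%classic _
  (index_enum 'I_n.+1)
  (fun i => eta i 0) (fun i s => kH H t s * (sigma s)^-1 * derive1 (phi i) s)
  (measurable_itv _) (fun i => kphi_int i tT).
apply: eq_Rintegral => s _; rewrite mulr_sumr.
by apply: eq_bigr => i _; ring.
Qed.

(** The primitives defining [Q eta] and the [psi_i] are linearly related at
    every point of ]0, T], hence near each point of ]0, T[, so that their
    derivatives are related wherever those of the [psi_primitive i] exist. *)
Lemma Q_linear_ae eta : {ae mu, forall s, 0 < s < T ->
  Q H phi sigma eta s = \sum_i eta i 0 * psi H phi sigma i s}.
Proof.
have Fmu := ae_filter_ringOfSetsType mu.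
have : {ae mu, forall s, forall i, 0 < s < T ->
    derivable (psi_primitive H phi sigma i) s 1}.
  exact: filter_forall.
apply: filterS => s ds sT.
rewrite /Q /ddw !derive1E.
under [RHS]eq_bigr => i _ do rewrite /psi /ddw derive1E mulrCA.
rewrite -mulr_sumr; congr (_ * _).
transitivity ('D_1 (\sum_i (eta i 0 *: psi_primitive H phi sigma i)) s).
  apply: near_eq_derive; near=> t.
  rewrite Q_primitive ?fct_sumE //.
  suff /andP[-> /ltW ->] : 0 < t < T by [].
  by near: t; exact: near_in_itvoo.
rewrite derive_sum => [|i]; last by apply: derivableZ; exact: ds.
by apply: eq_bigr => i _; rewrite deriveZ //; exact: ds.
Unshelve. all: by end_near. Qed.

End Score.

(** * From countably many parameters to all *)

Section RationalPoints.
Context {R : realType} {n : nat}.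

Lemma eq_continuous_rat (f g : 'cV[R]_n.+1 -> R) :
  continuous f -> continuous g ->
  (forall q : 'cV[rat]_n.+1, f (map_mx ratr q) = g (map_mx ratr q)) -> f =1 g.
Proof.
move=> cf cg fg x; apply/eqP; rewrite -subr_eq0; apply/negPn/negP => fgx.
have : (fun y => f y - g y) @ x --> f x - g x.
  exact: (cvgB (cf x) (cg x)).
move=> /cvgr_neq0 /(_ fgx) /nbhs_ballP[e /= e0 near_neq].
(* A rational vector within [e] of [x], coordinate by coordinate. *)
have nearq i : exists p, ratr p \in `](x i 0 - e), (x i 0 + e)[.
  by apply: rat_in_itvoo; lra.
have [q qP] := choice nearq.
have := near_neq (map_mx ratr (\col_i q i)); rewrite /= fg subrr eqxx => h.
suff : false by []; apply: h; split => // i j.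
rewrite ord1 !mxE; have := qP i; rewrite in_itv /= => /andP[q1 q2].
by rewrite -ball_normE /= ltr_norml; lra.
Qed.

End RationalPoints.

(** A countable union of null sets is null; [unpickle] enumerates [I]. *)
Lemma ae_forall_countable (d : measure_display) (T : measurableType d)
    (R : realType) (mu : {measure set T -> \bar R}) (I : countType)
    (A : I -> T -> Prop) :
  (forall i, {ae mu, forall x, A i x}) -> {ae mu, forall x, forall i, A i x}.
Proof.
move=> AI.
have : {ae mu, forall x, forall k, if unpickle k is Some i then A i x else True}.
  apply: ae_foralln => k; case: (unpickle k) => [i|]; first exact: AI.
  exact: aeW.
by apply: filterS => x Ax i; have := Ax (pickle i); rewrite pickleK.
Qed.

(** * The log-likelihood and its maximum *)

Section LogLikelihood.
Context {R : realType} {n : nat}.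
Implicit Types (A : 'M[R]_n.+1) (b x : 'cV[R]_n.+1).

Lemma bilinE A x y : bilin A x y = \sum_i \sum_j x i 0 * A i j * y j 0.
Proof.
rewrite /bilin mxE exchange_big /=; apply: eq_bigr => j _.
by rewrite mxE mulr_suml; apply: eq_bigr => i _; rewrite !mxE.
Qed.

Lemma row_colE x b : (x^T *m b) 0 0 = \sum_i x i 0 * b i 0.
Proof. by rewrite mxE; apply: eq_bigr => i _; rewrite mxE. Qed.

Lemma continuous_linear_sub_quadratic A b :
  continuous (fun x : 'cV[R]_n.+1 => (x^T *m b) 0 0 - 2^-1 * bilin A x x).
Proof.
rewrite (_ : (fun x => _) = fun x => \sum_i x i 0 * b i 0 -
    2^-1 * \sum_i \sum_j x i 0 * A i j * x j 0); last first.
  by apply/funext => x; rewrite row_colE bilinE.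
have coord i : continuous (fun x : 'cV[R]_n.+1 => x i 0).
  exact: coord_continuous.
have sum_cont (F : 'I_n.+1 -> 'cV[R]_n.+1 -> R) :
    (forall i, continuous (F i)) -> continuous (fun x => \sum_i F i x).
  move=> F_cont; apply: (@continuous_big R 'I_n.+1 +%R 0 xpredT _ _ _ F) => //.
  exact: add_continuous.
have lin_cont : continuous (fun x : 'cV[R]_n.+1 => \sum_i x i 0 * b i 0).
  apply: (sum_cont _) => i x; exact: (cvgM (coord i x) (cvg_cst (b i 0))).
have quad_cont : continuous (fun x : 'cV[R]_n.+1 =>
    \sum_i \sum_j x i 0 * A i j * x j 0).
  apply: (sum_cont _) => i; apply: (sum_cont _) => j x.
  exact: (cvgM (cvgM (coord i x) (cvg_cst (A i j))) (coord j x)).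
move=> x; exact: (cvgB (lin_cont x) (cvgM (cvg_cst (2^-1 : R)) (quad_cont x))).
Qed.

End LogLikelihood.

Theorem theorem2 (R : realType) (d : measure_display) (Om : measurableType d)
    (P : probability Om R) (n : nat) (H T : R)
    (phi : 'I_n.+1 -> R -> R) (sigma : R -> R) (theta : 'cV[R]_n.+1)
    (B xi M : R -> Om -> R) (Psi : R -> Om -> 'cV[R]_n.+1) :
  0 < H < 1 -> 0 < T ->
  is_fbm P H T B ->
  (forall i, (@lebesgue_measure R).-integrable `[0, T] (EFin \o phi i)) ->
  measurable_fun `[0, T] sigma ->
  (@lebesgue_measure R).-integrable `[0, T] (fun s => (sigma s ^+ 2)%:E) ->
  {ae @lebesgue_measure R, forall s, 0 < s < T -> sigma s != 0} ->
  (forall i, {ae @lebesgue_measure R, forall s, 0 < s < T ->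
     derivable (phi i) s 1}) ->
  (forall i t, 0 < t <= T -> (@lebesgue_measure R).-integrable `[0, t]
     (fun s => (kH H t s * (sigma s)^-1 * derive1 (phi i) s)%:E)) ->
  (forall i, {ae @lebesgue_measure R, forall t, 0 < t < T ->
     derivable (psi_primitive H phi sigma i) t 1}) ->
  (forall eta : 'cV[R]_n.+1, in_L2dw H T (Q H phi sigma eta)) ->
  (forall t w, 0 <= t <= T -> xi t w = drift phi theta t + sigma t * B t w) ->
  (forall t, 0 <= t <= T -> is_int_dxi P phi sigma theta B xi t (kH H t) (M t)) ->
  (forall t i, 0 <= t <= T ->
     is_int_dM P H M t (psi H phi sigma i) (fun w => Psi t w i 0)) ->
  forall t, 0 <= t <= T ->
    RH H phi sigma t \in unitmx ->
    is_mle P H phi sigma M t (fun w => invmx (RH H phi sigma t) *m Psi t w).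
Proof.
move=> H01 _ _ _ _ _ _ _ kphi_int prim_der QL2 _ Mdxi PsiM t /andP[t0 tT] uA.
set A := RH H phi sigma t in uA *.
have psiL2 i : in_L2dw H t (psi H phi sigma i).
  by apply: (in_L2dw_le H01 tT); rewrite -Q_delta.
have mM s : 0 <= s <= t -> measurable_fun setT (M s).
  move=> /andP[s0 st].
  by have [|[[]]|[]] := Mdxi s; rewrite ?s0 ?(le_trans st).
have QL2t (eta : 'cV[R]_n.+1) :
  in_L2dw H t (Q H phi sigma eta) := in_L2dw_le H01 tT (QL2 eta).
have psi_sumL2 (eta : 'cV[R]_n.+1) : measurable_fun `[0, t]
    (fun s => \sum_i eta i 0 * psi H phi sigma i s).
  by apply: measurable_sum => i; apply: measurable_funM => //; case: (psiL2 i).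
have Qae (eta : 'cV[R]_n.+1) : ae_eq (@lebesgue_measure R) `[0, t]%classic
    (fun s => \sum_i eta i 0 * psi H phi sigma i s) (Q H phi sigma eta).
  apply: (ae_open_eq_on_closed tT).
  have Fmu := ae_filter_ringOfSetsType (@lebesgue_measure R).
  apply: filterS
    (Q_linear_ae kphi_int prim_der eta) => s + sT.
  by move=> /(_ sT).
have QdM (eta : 'cV[R]_n.+1) : is_int_dM P H M t (Q H phi sigma eta)
    (fun w => \sum_i eta i 0 * Psi t w i 0).
  apply: (ae_eq_is_int_dM (psi_sumL2 eta) (QL2t eta).1 (Qae eta)).
  apply: (is_int_dM_sum H01 mM _ _ ord0) => i; first by case: (psiL2 i).
  by apply: PsiM; rewrite t0.
have Q2 (eta : 'cV[R]_n.+1) :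
    int_dw H t (fun s => Q H phi sigma eta s ^+ 2) = bilin A eta eta.
  transitivity
    (int_dw H t (fun s => (\sum_i eta i 0 * psi H phi sigma i s) ^+ 2)).
    congr fine; apply: ae_eq_integral => //.
    - exact: (measurable_sqr_dw_density _ (QL2t eta).1).
    - exact: (measurable_sqr_dw_density _ (psi_sumL2 eta)).
    have Fmu := ae_filter_ringOfSetsType (@lebesgue_measure R).
    apply: filterS (Qae eta).
    by move=> s /[apply] ->.
  rewrite int_dw_sqr_sum // bilinE.
  by apply: eq_bigr => i _; apply: eq_bigr => j _; rewrite mxE.
have sA : A^T = A.
  apply/matrixP => i j; rewrite !mxE; apply: eq_Rintegral => s _.
  move: (psi H phi sigma i s) (psi H phi sigma j s) => x y.
  by rewrite (mulrC y).
have A0 (eta : 'cV[R]_n.+1) : 0 <= bilin A eta eta.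
  rewrite -Q2; apply: Rintegral_ge0 => s _.
  by rewrite mulr_ge0 ?sqr_ge0 ?dw_density_ge0.
(* The logarithm of the likelihood, in the version that is continuous in the
   parameter. *)
pose ell w (eta : 'cV[R]_n.+1) := (eta^T *m Psi t w) 0 0 - 2^-1 * bilin A eta eta.
have ell_cont w : continuous (fun eta => expR (ell w eta)).
  move=> eta; apply: continuous_comp; last exact: continuous_expR.
  exact: continuous_linear_sub_quadratic.
split.
  exists (fun eta w => expR (ell w eta)); split; last exact: aeW.
  move=> eta; exists (fun w => \sum_i eta i 0 * Psi t w i 0); first exact: QdM.
  by apply: aeW => w; rewrite Q2 /ell row_colE.
move=> L [LI Lcont].
(* The given version may use other integrals [I]; uniqueness of the integral of
   [Q eta] identifies them with [eta^T Psi]. *)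
have Lrat : {ae P, forall w, forall q : 'cV[rat]_n.+1,
    L (map_mx ratr q) w = expR (ell w (map_mx ratr q))}.
  apply: ae_forall_countable => q.
  have [I [graphI _] LE] := LI (map_mx ratr q).
  have [_ uniqQ] := QdM (map_mx ratr q).
  apply: filterS2 LE (uniqQ I graphI) => w -> ->.
  by rewrite Q2 /ell row_colE.
apply: filterS2 Lrat Lcont => w Lw cLw.
have LE := eq_continuous_rat cLw (ell_cont w) Lw.
apply/seteqP; split => x; rewrite /argmax /=.
  move=> xmax; apply/(concave_quadratic_argmax _ _ sA A0 uA) => y.
  by have := xmax y; rewrite !LE ler_expR.
move=> /(concave_quadratic_argmax _ _ sA A0 uA) xmax y.
by rewrite !LE ler_expR; exact: xmax.
Qed.
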